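(* Let $T \subseteq \mathbb{R}^2$ be a (non-degenerate) triangle and let $x$ be the midpoint of an edge of $T$. Let $X_1, X_2$ be independent random points uniformly distributed in $T$, and let $V_{T,x} = \operatorname{vol}\operatorname{conv}(x, X_1, X_2)$. Then for every positive integer $k$, the $k$-th moment of $V_{T,x}$ satisfies $$\frac{\mathbb{E} V_{T,x}^k}{(\operatorname{vol} T)^k} = \frac{2^{3-k}}{(k+1)(k+2)^2(k+3)} \left(\sum_{l=1}^{k+1} \binom{k+2}{l}^{-1} + 1\right).$$
   Context: Here $\operatorname{vol}$ denotes area (two-dimensional Lebesgue measure), $\operatorname{conv}$ denotes the convex hull, and $\mathbb{E} V_{T,x}^k = \mathbb{E}[(V_{T,x})^k]$. *)

(* Defs.v *)
From HB Require Import structures.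
From mathcomp Require Import all_boot all_order all_algebra.
From mathcomp Require Import all_classical all_reals all_analysis.

Set Implicit Arguments.
Unset Strict Implicit.
Unset Printing Implicit Defensive.

Import Order.TTheory GRing.Theory Num.Theory.
Import numFieldNormedType.Exports.

Local Open Scope classical_set_scope.
Local Open Scope ring_scope.

Definition area (R : realType) (A : set (R * R)) : \bar R :=
  (lebesgue_measure \x lebesgue_measure)%E A.

Definition convex_hull (R : numDomainType) (M : lmodType R) (A : set M)
    : set M :=
  smallest (@convex_set R M) A.

Definition affinely_independent (R : pzRingType) (M : lmodType R) (n : nat)
    (v : 'I_n -> M) : Prop :=
  forall c : 'I_n -> R, \sum_i c i = 0 -> \sum_i c i *: v i = 0 ->
  forall i, c i = 0.

(* A non-degenerate triangle, given with an enumeration [v] of its vertices. *)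
Definition is_triangle (R : realType) (v : 'I_3 -> R * R) (T : set (R * R))
    : Prop :=
  affinely_independent v /\ T = convex_hull (range v).

Definition midpoint (R : numFieldType) (M : lmodType R) (a b : M) : M :=
  2^-1 *: (a + b).

Definition is_edge_midpoint (R : realType) (v : 'I_3 -> R * R) (x : R * R)
    : Prop :=
  exists i j : 'I_3, i != j /\ x = midpoint (v i) (v j).

Definition uniform_on (R : realType) (d : measure_display)
    (Omega : measurableType d) (P : probability Omega R)
    (T : set (R * R)) (X : {RV P >-> (R * R)%type}) : Prop :=
  forall A : set (R * R), measurable A ->
    distribution P X A = (area (A `&` T) / area T)%E.
Arguments uniform_on {R d Omega} P T X.

Definition independent_RVs (R : realType) (d d1 d2 : measure_display)
    (Omega : measurableType d) (E1 : measurableType d1)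
    (E2 : measurableType d2) (P : probability Omega R)
    (X : {RV P >-> E1}) (Y : {RV P >-> E2}) : Prop :=
  forall (A : set E1) (B : set E2), measurable A -> measurable B ->
    P (X @^-1` A `&` Y @^-1` B) = (P (X @^-1` A) * P (Y @^-1` B))%E.
Arguments independent_RVs {R d d1 d2 Omega E1 E2} P X Y.

(* [fine] loses nothing here: the hull of three points is bounded, so its area
   is finite. *)
Definition hull_area (R : realType) (x y z : R * R) : R :=
  fine (area (convex_hull [set x; y; z])).

(* Main.v *)
Require Import Defs.
From HB Require Import structures.
From mathcomp Require Import all_boot all_order all_algebra.
From mathcomp Require Import all_classical all_reals all_analysis.
From mathcomp Require Import measurable_realfun.
From mathcomp Require Import ring lra.

Set Implicit Arguments.
Unset Strict Implicit.
Unset Printing Implicit Defensive.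

Import Order.TTheory GRing.Theory Num.Theory.
Import numFieldNormedType.Exports.

Local Open Scope classical_set_scope.
Local Open Scope ring_scope.

(** Put the midpoint [x] of the chosen edge at the origin and write the triangle
    as [x + s e + t f] with [0 <= t] and [|s| + t <= 1], where [x - e], [x + e]
    are the ends of the edge and [x + f] is the third vertex. Its area is
    [D = |e /\ f|], and two of its points satisfy
    [vol conv (x, X1, X2) = D / 2 * |s1 t2 - s2 t1|], so only the law of
    [|s1 t2 - s2 t1|] matters, for points uniform on the standard triangle.

    The standard triangle is swept by the segments that leave the origin. In the
    coordinates [s = r u], [t = r (1 - |u|)], with [r] in [0, 1] and [u] in
    [-1, 1], the area element is [r dr du] (lemma [ge0_integral_std_triangle])
    and
    [|s1 t2 - s2 t1| = r1 r2 |u1 (1 - |u2|) - u2 (1 - |u1|)|].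
    The radii therefore separate from the directions: each radius contributes
    [1 / (k + 2)], and what is left is the integral of
    [|u1 (1 - |u2|) - u2 (1 - |u1|)| ^ k] over the square [-1, 1] x [-1, 1]
    (lemma [integral_directions]).

    The signs of [u1] and [u2] split that square in four; let [u = |u1|] and
    [v = |u2|]. When the signs agree, the integrand is [|u - v| ^ k] on the unit square. When they differ, it is
    [(u (1 - v) + v (1 - u)) ^ k]; expanding by the binomial theorem, every term
    is a product of two Beta integrals [B(i + 1, k - i + 1)], each equal to
    [1 / ((k + 1) C(k, i))], and the sum of the [1 / C(k, i)] remains. The sum
    of the theorem runs over row [k + 2] of Pascal's triangle instead: applying
    [sum_inv_bin_rec] twice passes from row [k] to row [k + 2]. *)

(** * Affine changes of variables for Lebesgue integrals *)

(** Scaling the preimage by [|a|] gives a measure that agrees with Lebesgue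
    measure on half-open intervals; the two cases are the signs of [a]. *)
Lemma lebesgue_measure_affine (R : realType) (a b : R) (A : set R) : a != 0 ->
  measurable A ->
  lebesgue_measure ((fun t : R => a * t + b) @^-1` A) =
  (`|a|^-1%:E * lebesgue_measure A)%E.
Proof.
move=> a0 mA.
have an0 : 0 < `|a| by rewrite normr_gt0.
pose phi : measurableTypeR R -> measurableTypeR R := fun t => a * t + b.
have mf : measurable_fun setT phi.
  by apply: measurable_funD => //; exact: measurable_funM.
pose nu : {measure set (measurableTypeR R) -> \bar R} :=
  mscale (NngNum (ltW an0)) (pushforward lebesgue_measure phi).
have -> : lebesgue_measure A = nu mf A; last first.
  by rewrite /nu /mscale /= muleA -EFinM mulVf ?gt_eqF// mul1e.
apply: lebesgue_measure_unique mA => _ [[u v] _ <-].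
rewrite [RHS](_ : _ = (`|a|%:E * lebesgue_measure (phi @^-1` `]u, v]))%E)//.
have [a_gt0|a_le0] := ltP 0 a.
  have -> : phi @^-1` `]u, v] = `](u - b) / a, (v - b) / a]%classic.
    apply/seteqP; split => t; rewrite /phi /= !in_itv /=;
    by rewrite ltr_pdivrMr // ler_pdivlMr // ltrBlDr lerBrDr mulrC.
  rewrite !lebesgue_measure_itv /= !lte_fin ltr_pM2r ?invr_gt0// ltrD2r.
  case: ifP => _; last by rewrite mule0.
  by rewrite -!EFinD -EFinM gtr0_norm //; congr EFin; field; rewrite gt_eqF.
have {a_le0} a_lt0 : a < 0 by rewrite lt_neqAle a0.
rewrite /=; have -> : phi @^-1` `]u, v] = `[(v - b) / a, (u - b) / a[%classic.
  apply/seteqP; split => t; rewrite /phi /= !in_itv /=;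
  by rewrite ler_ndivrMr // ltr_ndivlMr // ltrBlDr lerBrDr mulrC andbC.
rewrite !lebesgue_measure_itv /= !lte_fin ltr_nM2r ?invr_lt0// ltrD2r.
case: ifP => _; last by rewrite mule0.
by rewrite -!EFinD -EFinM ltr0_norm //; congr EFin; field; rewrite lt_eqF.
Qed.

Lemma ge0_integral_affine (R : realType) (a b : R) (g : R -> \bar R) : a != 0 ->
  measurable_fun setT g -> (forall t, 0 <= g t)%E ->
  (\int[lebesgue_measure]_t g (a * t + b)%R =
   `|a|^-1%:E * \int[lebesgue_measure]_t g t)%E.
Proof.
move=> a0 mg g0.
pose phi : measurableTypeR R -> measurableTypeR R := fun t => a * t + b.
have mf : measurable_fun setT phi.
  by apply: measurable_funD => //; exact: measurable_funM.
have an0 : 0 <= `|a|^-1 by rewrite invr_ge0.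
rewrite -(ge0_integral_mscale _ _ (NngNum an0)) //.
rewrite -(preimage_setT phi).
rewrite -(@ge0_integral_pushforward _ _ _ _ _ phi mf lebesgue_measure setT g) //.
apply: (eq_measure_integral (mscale (NngNum an0) lebesgue_measure)) => A mA _.
exact: lebesgue_measure_affine.
Qed.

Ltac measurable_poly :=
  repeat first
  [ exact: measurable_cst | exact: measurable_id | exact: measurable_fst | exact: measurable_snd
  | assumption
  | apply: measurable_fun_pair
  | apply: measurable_funD | apply: measurable_funB
  | apply: measurable_funM | apply: measurable_funN | apply: measurable_funX
  | apply: (measurableT_comp (@normr_measurable _ setT)) ].

Lemma fubini_lebesgue (R : realType) (f : R * R -> \bar R) :
  measurable_fun setT f -> (forall z, 0 <= f z)%E ->
  (\int[lebesgue_measure]_s \int[lebesgue_measure]_t f (s, t) =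
   \int[lebesgue_measure]_t \int[lebesgue_measure]_s f (s, t))%E.
Proof.
move=> mf f0.
exact: (@fubini_tonelli _ _ (measurableTypeR R) (measurableTypeR R) R
          lebesgue_measure lebesgue_measure f mf f0).
Qed.

Lemma measurable_lebesgue_integral1 (R : realType) (f : R * R -> \bar R) :
  measurable_fun setT f -> (forall z, 0 <= f z)%E ->
  measurable_fun [set: R] (fun s => \int[lebesgue_measure]_t f (s, t))%E.
Proof.
move=> mf f0.
exact: (@measurable_fun_fubini_tonelli_F _ _ (measurableTypeR R)
  (measurableTypeR R) R lebesgue_measure f mf f0).
Qed.

Lemma measurable_lebesgue_integral2 (R : realType) (f : R * R -> \bar R) :
  measurable_fun setT f -> (forall z, 0 <= f z)%E ->
  measurable_fun [set: R] (fun t => \int[lebesgue_measure]_s f (s, t))%E.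
Proof.
move=> mf f0.
exact: (@measurable_fun_fubini_tonelli_G _ _ (measurableTypeR R)
  (measurableTypeR R) R lebesgue_measure f mf f0).
Qed.

(** Gaussian elimination with pivot [a]: an affine substitution in [s] for fixed
    [t], then one in [t] for fixed first coordinate, whose slope is the Schur
    complement [(a * d - b * c) / a]. *)
Lemma ge0_integral_affine2_pivot (R : realType) (p1 p2 a b c d : R) (g : R * R -> \bar R) :
  a != 0 -> a * d - b * c != 0 ->
  measurable_fun setT g -> (forall z, 0 <= g z)%E ->
  (\int[lebesgue_measure]_s \int[lebesgue_measure]_t
      g (p1 + a * s + b * t, p2 + c * s + d * t)%R =
   `|a * d - b * c|^-1%:E *
     \int[lebesgue_measure]_y \int[lebesgue_measure]_z g (y, z))%E.
Proof.
move=> a0 det0 mg g0.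
(* [h] is the integrand after the first substitution, in the variables
   (first coordinate, [t]). *)
pose h (z : R * R) := g (z.1, p2 + c * ((z.1 - p1 - b * z.2) / a) + d * z.2).
have mh : measurable_fun setT h by apply: measurableT_comp => //; measurable_poly.
have h0 z : (0 <= h z)%E by exact: g0.
pose f (z : R * R) := g (p1 + a * z.1 + b * z.2, p2 + c * z.1 + d * z.2).
have mf : measurable_fun setT f by apply: measurableT_comp => //; measurable_poly.
have f0 z : (0 <= f z)%E by exact: g0.
rewrite [LHS](_ : _ = \int[lebesgue_measure]_t \int[lebesgue_measure]_s f (s, t))%E; last first.
  exact: (fubini_lebesgue mf).
have fE (s t : R) : f (s, t) = h (a * s + (p1 + b * t), t).
  by rewrite /f /h /=; congr (g (_, _)); [ring | field].
have hE (y t : R) :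
    h (y, t) = g (y, (a * d - b * c) / a * t + (p2 + c * ((y - p1) / a))).
  by rewrite /h /=; congr (g (_, _)); field.
transitivity (\int[lebesgue_measure]_t (`|a|^-1%:E * \int[lebesgue_measure]_y h (y, t)))%E.
  apply: eq_integral => t _.
  rewrite -(@ge0_integral_affine _ a (p1 + b * t) (fun y => h (y, t))) //; last first.
    exact: measurableT_comp.
  by apply: eq_integral => s _; exact: fE.
rewrite ge0_integralZl //; last 2 first.
- exact: (measurable_lebesgue_integral2 mh).
- by move=> t _; apply: integral_ge0.
rewrite -(fubini_lebesgue mh h0).
transitivity (`|a|^-1%:E * \int[lebesgue_measure]_y
    (`|(a * d - b * c) / a|^-1%:E * \int[lebesgue_measure]_z g (y, z)))%E.
  congr (_ * _)%E; apply: eq_integral => y _.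
  rewrite -(@ge0_integral_affine _ _ (p2 + c * ((y - p1) / a)) (fun z => g (y, z))) //.
  - by apply: eq_integral => t _; exact: hE.
  - by rewrite mulf_neq0 // invr_eq0.
  - exact: measurableT_comp.
rewrite ge0_integralZl //; last 2 first.
- exact: (measurable_lebesgue_integral1 mg).
- by move=> t _; apply: integral_ge0.
rewrite muleA -EFinM -invfM -normrM; congr ((`|_|^-1)%:E * _)%E.
by field.
Qed.

(** If the pivot [a] vanishes then [b] does not, and exchanging the two
    integrations exchanges their roles. *)
Lemma ge0_integral_affine2 (R : realType) (p1 p2 a b c d : R) (g : R * R -> \bar R) :
  a * d - b * c != 0 ->
  measurable_fun setT g -> (forall z, 0 <= g z)%E ->
  (\int[lebesgue_measure]_s \int[lebesgue_measure]_t
      g (p1 + a * s + b * t, p2 + c * s + d * t)%R =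
   `|a * d - b * c|^-1%:E *
     \int[lebesgue_measure]_y \int[lebesgue_measure]_z g (y, z))%E.
Proof.
move=> det0 mg g0; have [a0|a0] := eqVneq a 0; last exact: ge0_integral_affine2_pivot.
have b0 : b != 0 by apply: contra det0 => /eqP ->; rewrite a0; apply/eqP; ring.
pose f (z : R * R) := g (p1 + a * z.1 + b * z.2, p2 + c * z.1 + d * z.2).
have mf : measurable_fun setT f by apply: measurableT_comp => //; measurable_poly.
have f0 z : (0 <= f z)%E by exact: g0.
rewrite [LHS](_ : _ = \int[lebesgue_measure]_t \int[lebesgue_measure]_s f (s, t))%E; last first.
  exact: (fubini_lebesgue mf).
rewrite /f; under eq_integral do under eq_integral do rewrite /= addrAC [(p2 + _ + _)%R]addrAC.
rewrite ge0_integral_affine2_pivot //; last by rewrite -oppr_eq0 opprB mulrC (mulrC d).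
by rewrite distrC.
Qed.

(** * Polar coordinates from the midpoint of an edge *)

(** The triangle with vertices [(-1, 0)], [(1, 0)], [(0, 1)]: the origin is the
    midpoint of its base. *)
Definition std_triangle (R : realType) : set (R * R) :=
  [set z | 0 <= z.2 /\ `|z.1| + z.2 <= 1].
Arguments std_triangle : clear implicits.

Lemma measurable_std_triangle (R : realType) : measurable (std_triangle R).
Proof.
have m1 : measurable_fun [set: R * R] (fun z => z.2 : R) by measurable_poly.
have m2 : measurable_fun [set: R * R] (fun z => `|z.1| + z.2 : R) by measurable_poly.
have -> : std_triangle R =
    ([set: R * R] `&` (fun z => z.2) @^-1` `[0, +oo[) `&`
    ([set: R * R] `&` (fun z => `|z.1| + z.2) @^-1` `]-oo, 1]).
  apply/seteqP; split => z; rewrite /std_triangle /= !in_itv /= andbT.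
    by move=> [].
  by move=> [[_ ?] [_ ?]].
by apply: measurableI; [apply: m1|apply: m2].
Qed.

(** Substitute [t = r - |s|] for fixed [s], exchange the integrations, and scale
    [s = r u] for fixed [r]: the first step preserves Lebesgue measure and the
    second one produces the factor [r]. *)
Lemma ge0_integral_std_triangle (R : realType) (G : R * R -> \bar R) :
  measurable_fun setT G -> (forall z, 0 <= G z)%E ->
  (\int[lebesgue_measure]_s \int[lebesgue_measure]_t (G \_ (std_triangle R)) (s, t) =
   \int[lebesgue_measure]_(r in `[0%R, 1%R])
     \int[lebesgue_measure]_(u in `[(-1)%R, 1%R]) (r%:E * G (r * u, r * (1 - `|u|))%R))%E.
Proof.
move=> mG G0.
pose f := G \_ (std_triangle R).
have mf : measurable_fun setT f.
  by apply/(measurable_restrictT _ _).1; [exact: measurable_std_triangle|exact: measurable_funTS].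
have f0 z : (0 <= f z)%E by rewrite /f /patch; case: ifP.
have fE s t : f (s, t) = if (0 <= t) && (`|s| + t <= 1) then G (s, t) else 0%E.
  rewrite /f patchE; congr (if _ then _ else _).
  by apply/idP/idP; rewrite inE /std_triangle /= => /andP.
pose h (z : R * R) := f (z.1, z.2 - `|z.1|).
have mh : measurable_fun setT h by apply: measurableT_comp => //; measurable_poly.
have h0 z : (0 <= h z)%E by exact: f0.
have hE (s r : R) : h (s, r) = if `|s| <= r <= 1 then G (s, r - `|s|) else 0%E.
  by rewrite /h fE /= subr_ge0 addrC subrK.
transitivity (\int[lebesgue_measure]_s \int[lebesgue_measure]_r h (s, r))%E.
  apply: eq_integral => s _.
  rewrite -[LHS]mul1e -[X in (X%:E * _)%E]invr1 -[X in (X^-1%:E * _)%E]normr1.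
  rewrite -(@ge0_integral_affine _ _ (- `|s|) (fun t => f (s, t))) //.
    by apply: eq_integral => t _; rewrite mul1r.
  exact: measurableT_comp.
rewrite (fubini_lebesgue mh h0) [RHS]integral_mkcond.
have inner (r : R) : (\int[lebesgue_measure]_s h (s, r) = if (0 <= r <= 1)%R then
    \int[lebesgue_measure]_(u in `[(-1)%R, 1%R]) (r%:E * G (r * u, r * (1 - `|u|))%R)
    else 0)%E.
  case: ifPn => r01; last first.
    rewrite integral0_eq // => s _; rewrite hE ifF //; apply: contraNF r01.
    by case/andP=> sr ->; rewrite (le_trans _ sr).
  have [r0|r0] := eqVneq r 0.
    (* The scaling degenerates at [r = 0], where the fibre is the origin alone. *)
    rewrite r0; under [RHS]eq_integral do rewrite mul0e.
    rewrite integral0 -[RHS](@integral_set1 R (fun s => h (s, 0)) 0).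
    rewrite [RHS]integral_mkcond; apply: eq_integral => s _.
    rewrite patchE; case: ifPn => //; rewrite notin_setE /= => s0.
    rewrite hE ifF //; apply/negbTE; apply: contra_notN s0 => /andP[+ _].
    by rewrite normr_le0 => /eqP.
  have {r0} r0 : 0 < r by rewrite lt_neqAle eq_sym r0; case/andP: r01.
  transitivity (r%:E * \int[lebesgue_measure]_u h (r * u + 0, r)%R)%E.
    rewrite (@ge0_integral_affine _ _ _ (fun s => h (s, r))) ?gt_eqF//; last first.
      exact: measurableT_comp.
    by rewrite gtr0_norm // muleA -EFinM divff ?gt_eqF// mul1e.
  rewrite -ge0_integralZl //; last 2 first.
  - have mh' : measurable_fun [set: R] (fun u => h (r * u + 0, r)).
      by apply: measurableT_comp => //; measurable_poly.
    exact: mh'.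
  - by rewrite lee_fin ltW.
  rewrite [RHS]integral_mkcond; apply: eq_integral => u _.
  have uE : (r%:E * h (r * u + 0, r)%R = if (`|u : R| <= 1)%R then
      r%:E * G (r * u, r * (1 - `|u|))%R else 0)%E.
    rewrite hE addr0 normrM gtr0_norm // ger_pMr // mulrBr mulr1.
    case/andP: r01 => _ ->; rewrite andbT; case: ifP => // _.
    by rewrite mule0.
  by rewrite uE patchE mem_setE in_itv /= ler_norml.
apply: eq_integral => r _.
by rewrite inner patchE mem_setE in_itv.
Qed.

Lemma integral_deriv_horner (R : realType) (p : {poly R}) (a b : R) : a <= b ->
  (\int[lebesgue_measure]_(x in `[a, b]) (p^`()).[x]%:E = (p.[b] - p.[a])%:E)%E.
Proof.
rewrite le_eqVlt => /predU1P[->|ab].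
  by rewrite set_itv1 integral_set1 subrr.
have cp (q : {poly R}) : continuous (horner q).
  by move=> x; apply/differentiable_continuous/derivable1_diffP/derivable_horner.
rewrite (@continuous_FTC2 _ _ (horner p)) //.
- by apply: continuous_subspaceT.
- split.
  + by move=> x _; exact: derivable_horner.
  + exact/cvg_at_right_filter/cp.
  + exact/cvg_at_left_filter/cp.
- by move=> x _; rewrite derivE.
Qed.

Lemma integral_affine_power (R : realType) (n : nat) (e c a b : R) :
  e != 0 -> a <= b ->
  (\int[lebesgue_measure]_(x in `[a, b]) ((e * x + c) ^+ n)%:E =
   (((e * b + c) ^+ n.+1 - (e * a + c) ^+ n.+1) / (e * n.+1%:R))%:E)%E.
Proof.
move=> e0 ab; pose p : {poly R} := (e * n.+1%:R)^-1 *: (e *: 'X + c%:P) ^+ n.+1.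
have pE x : p.[x] = (e * n.+1%:R)^-1 * (e * x + c) ^+ n.+1 by rewrite /p !hornerE.
have p'E x : (p^`()).[x] = (e * x + c) ^+ n.
  rewrite /p derivZ deriv_exp !(derivD, derivZ, derivX, derivC) /= !hornerE /=.
  by rewrite hornerMn !hornerE /= -mulr_natl; field; rewrite e0 /= addrC natr1 pnatr_eq0.
under eq_integral do rewrite -p'E.
by rewrite integral_deriv_horner // !pE -mulrBr mulrC.
Qed.

Definition wedge (R : realType) (e f : R * R) : R := e.1 * f.2 - f.1 * e.2.

Definition frame (R : realType) (m e f z : R * R) : R * R :=
  (m.1 + e.1 * z.1 + f.1 * z.2, m.2 + e.2 * z.1 + f.2 * z.2).

(** The triangle with vertices [m - e], [m + e] and [m + f]. The definition as
    an image, rather than by inequalities on [coframe], covers collinear [e] and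
    [f]. *)
Definition median_triangle (R : realType) (m e f : R * R) : set (R * R) :=
  frame m e f @` std_triangle R.

(** Cramer's rule for the inverse of [frame m e f]. *)
Definition coframe (R : realType) (m e f w : R * R) : R * R :=
  (((w.1 - m.1) * f.2 - f.1 * (w.2 - m.2)) / wedge e f,
   (e.1 * (w.2 - m.2) - (w.1 - m.1) * e.2) / wedge e f).

Lemma frameK (R : realType) (m e f : R * R) : wedge e f != 0 ->
  cancel (frame m e f) (coframe m e f).
Proof.
by move=> w0 [s t]; rewrite /coframe /frame /wedge /=; congr (_, _); field.
Qed.

Lemma coframeK (R : realType) (m e f : R * R) : wedge e f != 0 ->
  cancel (coframe m e f) (frame m e f).
Proof.
move=> w0; case: m => m1 m2 [y z]; rewrite /coframe /frame /=; congr (_, _);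
  by move: w0; rewrite /wedge => w0; field.
Qed.

Lemma mem_median_triangle (R : realType) (m e f z : R * R) : wedge e f != 0 ->
  (frame m e f z \in median_triangle m e f) = (z \in std_triangle R).
Proof.
move=> w0; apply/idP/idP; rewrite !inE; last by exists z.
by move=> [z' Dz'] /(can_inj (frameK m w0)) <-.
Qed.

Lemma measurable_frame (R : realType) (m e f : R * R) :
  measurable_fun setT (frame m e f).
Proof. rewrite /frame; measurable_poly. Qed.

Lemma measurable_median_triangle (R : realType) (m e f : R * R) :
  wedge e f != 0 -> measurable (median_triangle m e f).
Proof.
move=> w0.
have mc : measurable_fun setT (coframe m e f) by rewrite /coframe; measurable_poly.
rewrite (_ : median_triangle m e f = [set: R * R] `&` coframe m e f @^-1` std_triangle R).
  by apply: mc => //; exact: measurable_std_triangle.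
apply/seteqP; split => w.
  by move=> [z Dz <-]; split => //; rewrite /= frameK.
by move=> [_ /= Dw]; exists (coframe m e f w) => //; exact: coframeK.
Qed.

Lemma ge0_integral_median_triangle (R : realType) (m e f : R * R)
    (G : R * R -> \bar R) :
  wedge e f != 0 -> measurable_fun setT G -> (forall z, 0 <= G z)%E ->
  (\int[lebesgue_measure \x lebesgue_measure]_(z in median_triangle m e f) G z =
   `|wedge e f|%:E * \int[lebesgue_measure]_(r in `[0%R, 1%R])
     \int[lebesgue_measure]_(u in `[(-1)%R, 1%R])
       (r%:E * G (frame m e f (r * u, r * (1 - `|u|))%R)))%E.
Proof.
move=> w0 mG G0.
have wn0 : `|wedge e f| != 0 by rewrite normr_eq0.
pose g := G \_ (median_triangle m e f).
have mg : measurable_fun setT g.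
  apply/(measurable_restrictT _ _).1; [exact: measurable_median_triangle|].
  exact: measurable_funTS.
have g0 z : (0 <= g z)%E by rewrite /g /patch; case: ifP.
have mGf : measurable_fun setT (G \o frame m e f).
  by apply: measurableT_comp => //; exact: measurable_frame.
rewrite -(ge0_integral_std_triangle mGf) //; last by move=> z; exact: G0.
rewrite integral_mkcond.
rewrite (@fubini_tonelli1 _ _ (measurableTypeR R) (measurableTypeR R) R
          lebesgue_measure lebesgue_measure g mg g0) /fubini_F.
transitivity (`|wedge e f|%:E * (`|wedge e f|^-1%:E *
    \int[lebesgue_measure]_y \int[lebesgue_measure]_z g (y, z)))%E.
  by rewrite muleA -EFinM divff // mul1e.
rewrite -(ge0_integral_affine2 m.1 m.2 w0 mg g0); congr (_ * _)%E.
apply: eq_integral => s _; apply: eq_integral => t _.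
by rewrite /g !patchE -(mem_median_triangle m (s, t) w0).
Qed.

Lemma area_median_triangle_neq0 (R : realType) (m e f : R * R) : wedge e f != 0 ->
  area (median_triangle m e f) = `|wedge e f|%:E.
Proof.
move=> w0.
rewrite /area -[LHS]mul1e -integral_cst; last exact: measurable_median_triangle.
rewrite (ge0_integral_median_triangle _ w0 (measurable_cst _)) //.
rewrite -[RHS]mule1; congr (_ * _)%E.
transitivity (\int[lebesgue_measure]_(r in `[0%R, 1%R]) ((2 * r + 0) ^+ 1)%:E : \bar R)%E.
  apply: eq_integral => r _.
  under eq_integral do rewrite mule1.
  rewrite integral_cst //=.
  rewrite [X in (_ * X)%E]lebesgue_measure_itv /= lte_fin.
  rewrite ifT; last by lra.
  by rewrite -!EFinD -EFinM; congr EFin; rewrite expr1; ring.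
rewrite integral_affine_power ?ler01 ?pnatr_eq0 //; congr EFin.
by rewrite !addr0 mulr1 mulr0 expr0n subr0 /=; field.
Qed.

(** * Convex hulls of three points *)

Lemma convex_set_segment (R : realType) (M : lmodType R) (A : set M) (x y : M) (t : R) :
  @convex_set R M A -> 0 <= t -> t <= 1 -> A x -> A y ->
  A (t *: x + (1 - t) *: y).
Proof.
move=> cA t0 t1 Ax Ay.
have := cA x y (Itv01 t0 t1); rewrite !inE; exact.
Qed.

Lemma convex_median_triangle (R : realType) (m e f : R * R) :
  @convex_set R (R * R)%type (median_triangle m e f).
Proof.
move=> x y l; rewrite !inE => -[[s t] [/= t0 st] <-] [[s' t'] [/= t'0 st'] <-].
have l0 : 0 <= l%:num by [].
have l1 : 0 <= 1 - l%:num by rewrite subr_ge0.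
exists (l%:num * s + (1 - l%:num) * s', l%:num * t + (1 - l%:num) * t').
  split => /=; first by rewrite addr_ge0 // mulr_ge0.
  have := ler_normD (l%:num * s) ((1 - l%:num) * s').
  rewrite !normrM (ger0_norm l0) (ger0_norm l1).
  by nra.
rewrite /frame /=; congr (_, _).
  rewrite [RHS](_ : _ = l%:num * (m.1 + e.1 * s + f.1 * t) +
    (1 - l%:num) * (m.1 + e.1 * s' + f.1 * t')) //.
  by ring.
rewrite [RHS](_ : _ = l%:num * (m.2 + e.2 * s + f.2 * t) +
    (1 - l%:num) * (m.2 + e.2 * s' + f.2 * t')) //.
by ring.
Qed.

Lemma frame_midpointE (R : realType) (a b c z : R * R) :
  frame (midpoint a b) (2^-1 *: (b - a)) (c - midpoint a b) z =
  (2^-1 * (a.1 + b.1) + (2^-1 * (b.1 - a.1)) * z.1 + (c.1 - 2^-1 * (a.1 + b.1)) * z.2,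
   2^-1 * (a.2 + b.2) + (2^-1 * (b.2 - a.2)) * z.1 + (c.2 - 2^-1 * (a.2 + b.2)) * z.2).
Proof. by []. Qed.

(** A point of the hull with weight [t] on [c] lies between [c] and a point of
    the segment from [a] to [b]. *)
Lemma convex_hull_triple (R : realType) (a b c : R * R) :
  convex_hull [set a; b; c] =
  median_triangle (midpoint a b) (2^-1 *: (b - a)) (c - midpoint a b).
Proof.
apply/seteqP; split.
  apply: smallest_sub; first exact: convex_median_triangle.
  move=> _ [[->|->]|->].
  - exists (-1, 0); first by split => //=; rewrite normrN normr1 addr0.
    by rewrite frame_midpointE [RHS]surjective_pairing /=; congr (_, _); field.
  - exists (1, 0); first by split => //=; rewrite normr1 addr0.
    by rewrite frame_midpointE [RHS]surjective_pairing /=; congr (_, _); field.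
  - exists (0, 1); first by split => //=; rewrite normr0 add0r.
    by rewrite frame_midpointE [RHS]surjective_pairing /=; congr (_, _); field.
move=> _ [[s t] [/= t0 st] <-] A [cA sA].
have Aa : A a by apply: sA; left; left.
have Ab : A b by apply: sA; left; right.
have Ac : A c by apply: sA; right.
have s0 := normr_ge0 s; have := ler_norm s; have := ler_norm (- s); rewrite normrN => s1 s2.
have [t1|t1] := eqVneq t 1.
  have -> : s = 0 by apply/eqP; rewrite -normr_eq0; apply/eqP; lra.
  rewrite t1 (_ : frame _ _ _ _ = c) //.
  by rewrite frame_midpointE [RHS]surjective_pairing /=; congr (_, _); field.
have t1' : 0 < 1 - t by rewrite subr_gt0 lt_neqAle t1 /=; lra.
(* [l] is the weight of [a] relative to that of [b], once [t] is given to [c]. *)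
pose l := (1 - t - s) / (2 * (1 - t)).
have l0 : 0 <= l by rewrite divr_ge0; lra.
have l1 : l <= 1 by rewrite ler_pdivrMr; lra.
have Aab := convex_set_segment cA l0 l1 Aa Ab.
have tle1 : t <= 1 by lra.
have := convex_set_segment cA t0 tle1 Ac Aab.
congr A; rewrite /l; have {}t1' : 1 - t != 0 by rewrite gt_eqF.
rewrite frame_midpointE [LHS]surjective_pairing.
by congr (_, _); rewrite /GRing.scale /= /GRing.scale /=; field.
Qed.

(** The vertical sections of a non-vertical line are points; a vertical line has
    only one nonempty section. *)
Lemma area_subset_line (R : realType) (a b c : R) (A : set (R * R)) :
  (a != 0) || (b != 0) -> A `<=` [set w | a * w.1 + b * w.2 = c] -> area A = 0%E.
Proof.
move=> ab0 Aline; rewrite /area /= /product_measure1 /=.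
have [b0|b0] := eqVneq b 0.
  have a0 : a != 0 by move: ab0; rewrite b0 eqxx orbF.
  rewrite -(@integral_set1 R (fun x => lebesgue_measure (xsection A x)) (c / a)).
  rewrite [RHS]integral_mkcond; apply: eq_integral => x _.
  rewrite patchE; case: ifPn => //; rewrite notin_setE /= => xc.
  rewrite (_ : xsection A x = set0) ?measure0 //.
  apply/seteqP; split => // y /=; rewrite /xsection /= inE => /Aline /=.
  by rewrite b0 mul0r addr0 => ax; apply: xc; rewrite -ax mulrC mulKf.
apply: integral0_eq => x _ /=.
have : xsection A x `<=` [set (c - a * x) / b].
  move=> y /=; rewrite /xsection /= inE => /Aline /= <-.
  by rewrite addrAC subrr add0r mulrC mulKf.
by move=> /subset_set1[] ->; rewrite ?measure0 ?lebesgue_measure_set1.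
Qed.

Lemma wedge_eq0 (R : realType) (e f : R * R) : wedge e f = 0 ->
  exists a b : R, [/\ (a != 0) || (b != 0),
    a * e.1 + b * f.1 = 0 & a * e.2 + b * f.2 = 0].
Proof.
rewrite /wedge => w0; have [f10|f10] := eqVneq f.1 0; last first.
  by exists f.1, (- e.1); split; rewrite ?f10 //; lra.
have [f20|f20] := eqVneq f.2 0; last first.
  by exists f.2, (- e.2); split; rewrite ?f20 //; lra.
by exists 0, 1; split; rewrite ?oner_eq0 ?orbT // ?f10 ?f20; ring.
Qed.

(** In the collinear case the triangle is contained in a line. The formula is
    needed there as well, since [X1] and [X2] may be aligned with [x]. *)
Lemma area_median_triangle (R : realType) (m e f : R * R) :
  area (median_triangle m e f) = `|wedge e f|%:E.
Proof.
have [w0|w0] := eqVneq (wedge e f) 0; last exact: area_median_triangle_neq0.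
rewrite w0 normr0.
(* The transposed system: [(a, b)] is a common normal to [e] and [f]. *)
have [|a [b [ab0 h1 h2]]] := @wedge_eq0 R (e.1, f.1) (e.2, f.2).
  by move: w0; rewrite /wedge /= => w0; lra.
apply: (@area_subset_line _ a b (a * m.1 + b * m.2)) => // _ [z _ <-].
rewrite /frame /=; move: h1 h2; rewrite /= => h1 h2.
have -> : a * (m.1 + e.1 * z.1 + f.1 * z.2) + b * (m.2 + e.2 * z.1 + f.2 * z.2) =
  a * m.1 + b * m.2 + (a * e.1 + b * e.2) * z.1 + (a * f.1 + b * f.2) * z.2 by ring.
by rewrite h1 h2; ring.
Qed.

Lemma hull_areaE (R : realType) (x y z : R * R) :
  hull_area x y z = `|wedge (y - x) (z - x)| / 2.
Proof.
rewrite /hull_area convex_hull_triple area_median_triangle /=.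
rewrite -[2 in RHS]gtr0_norm // -normf_div; congr `| _ |.
rewrite /wedge /midpoint /= /GRing.scale /=.
by field.
Qed.

Lemma ord3_third (i j : 'I_3) : i != j ->
  exists l : 'I_3, [/\ l != i, l != j & forall n, [|| n == i, n == j | n == l]].
Proof.
case: i j => [[|[|[|//]]] hi] [[|[|[|//]]] hj] // _.
all: [> exists (inord 2) | exists (inord 1) | exists (inord 2)
     | exists (inord 0) | exists (inord 1) | exists (inord 0) ].
all: split; rewrite -?val_eqE /= ?inordK //.
all: by move=> [[|[|[|//]]] hn]; rewrite -!val_eqE /= ?inordK.
Qed.

(** A linear relation between [v j - v i] and [v l - v i] is an affine relation
    between the three vertices. *)
Lemma wedge_affinely_independent (R : realType) (v : 'I_3 -> R * R) (i j l : 'I_3) :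
  affinely_independent v -> i != j -> l != i -> l != j ->
  (forall n, [|| n == i, n == j | n == l]) ->
  wedge (v j - v i) (v l - v i) != 0.
Proof.
move=> av ij li lj all3; apply/negP => /eqP /wedge_eq0 [a [b [ab0 h1 h2]]].
pose c n := if n == i then - a - b else if n == j then a else b.
have sum3 (V : zmodType) (F : 'I_3 -> V) : \sum_n F n = F i + F j + F l.
  rewrite (bigD1 i) //= (bigD1 j) 1?eq_sym //= (big_pred1 l) ?addrA //.
  move=> n /=; have := all3 n; case: (eqVneq n i) => [->|ni] /=.
    by rewrite eq_sym (negbTE li).
  by case: (eqVneq n j) => [->|nj] //=; rewrite eq_sym (negbTE lj).
have ci : c i = - a - b by rewrite /c eqxx.
have cj : c j = a by rewrite /c eqxx eq_sym (negbTE ij).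
have cl : c l = b by rewrite /c (negbTE li) (negbTE lj).
have c0 := av c.
rewrite !sum3 ci cj cl in c0.
have {}c0 : forall n, c n = 0.
  apply: c0; first by ring.
  rewrite [LHS]surjective_pairing; congr (_, _).
    by move: h1; rewrite /= /GRing.scale /= => h1; lra.
  by move: h2; rewrite /= /GRing.scale /= => h2; lra.
by move: ab0; rewrite -cj -cl !c0 eqxx.
Qed.

Lemma is_triangle_median (R : realType) (v : 'I_3 -> R * R) (T : set (R * R))
    (x : R * R) : is_triangle v T -> is_edge_midpoint v x ->
  exists e f, wedge e f != 0 /\ T = median_triangle x e f.
Proof.
move=> [av ->] [i [j [ij ->]]].
have [l [li lj all3]] := ord3_third ij.
exists (2^-1 *: (v j - v i)), (v l - midpoint (v i) (v j)); split.
  have := wedge_affinely_independent av ij li lj all3.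
  apply: contra_neq => w0.
  rewrite -[RHS](mulr0 2) -w0 /wedge /midpoint /= /GRing.scale /=.
  by field.
rewrite -convex_hull_triple; congr convex_hull.
apply/seteqP; split => [_ [n _ <-]|_ [[->|->]|->]]; [|by exists i|by exists j|by exists l].
by case/or3P: (all3 n) => /eqP ->; [left; left|left; right|right].
Qed.

(** * Independent and uniform points *)

(** By independence the law of [(X, Y)] agrees with the product of the two laws
    on rectangles, hence everywhere, and Tonelli's theorem applies. *)
Lemma ge0_integral_independent (R : realType) (d d1 d2 : measure_display)
    (Omega : measurableType d) (E1 : measurableType d1) (E2 : measurableType d2)
    (P : probability Omega R) (X : {RV P >-> E1}) (Y : {RV P >-> E2})
    (F : E1 * E2 -> \bar R) :
  independent_RVs P X Y -> measurable_fun setT F -> (forall z, 0 <= F z)%E ->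
  (\int[P]_w F (X w, Y w) =
   \int[distribution P X]_y \int[distribution P Y]_z F (y, z))%E.
Proof.
move=> XY mF F0.
pose Z w := (X w, Y w).
have mZ : measurable_fun setT Z by apply: measurable_fun_pair; exact: measurable_funP.
rewrite -(@fubini_tonelli1 _ _ _ _ R (distribution P X) (distribution P Y) F mF F0).
pose ZP : {RV P >-> (E1 * E2)%type} := HB.pack Z (isMeasurableFun.Build _ _ _ _ _ mZ).
rewrite [LHS](_ : _ = \int[distribution P ZP]_z F z)%E; last first.
  by rewrite ge0_integral_distribution.
apply: eq_measure_integral => A mA _; apply/esym.
apply: (@product_measure_unique _ _ _ _ R (distribution P X)
  (distribution P Y) (distribution P ZP)) => // B C mB mC.
Qed.

Lemma ge0_integral_uniform_on (R : realType) (d : measure_display)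
    (Omega : measurableType d) (P : probability Omega R) (T : set (R * R))
    (X : {RV P >-> (R * R)%type}) (D : R) (G : R * R -> \bar R) :
  uniform_on P T X -> measurable T -> 0 < D -> area T = D%:E ->
  measurable_fun setT G -> (forall z, 0 <= G z)%E ->
  (\int[distribution P X]_z G z =
   D^-1%:E * \int[lebesgue_measure \x lebesgue_measure]_(z in T) G z)%E.
Proof.
move=> uX mT D0 areaT mG G0.
have Di0 : 0 <= D^-1 by rewrite invr_ge0 ltW.
(* The measurable structure of the domain of Lebesgue measure has the same
   sets as that of [R] but another display, so [X] is first regarded as a
   random variable [X'] with values in that space. *)
pose RR : measurableType _ := (measurableTypeR R * measurableTypeR R)%type.
have mX : measurable_fun setT (X : Omega -> RR) by exact: (measurable_funP X).
pose X' : {RV P >-> RR} := HB.pack (X : Omega -> RR) (isMeasurableFun.Build _ _ _ _ _ mX).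
have mG' : measurable_fun (setT : set RR) G by exact: mG.
have mT' : measurable (T : set RR) by exact: mT.
have -> : (\int[distribution P X]_z G z = \int[distribution P X']_z G z)%E.
  by rewrite (ge0_integral_distribution X) // (ge0_integral_distribution X').
have distE (A : set RR) : measurable A -> distribution P X' A = (D^-1%:E * area (A `&` T))%E.
  by move=> mA; rewrite [LHS]uX // areaT muleC inver gt_eqF.
rewrite -(setUv (T : set RR)) ge0_integral_setU //=; last 3 first.
- exact: measurableC.
- by rewrite setUv.
- by apply/disj_set2P; rewrite setICr.
rewrite [X in (_ + X)%E](_ : _ = 0%E) ?adde0; last first.
  rewrite -(integral_measure_zero (~` T : set RR) G).
  apply: eq_measure_integral => A mA AT.
  rewrite [LHS]distE // (_ : A `&` T = set0); last first.
    by apply/seteqP; split => // z [/AT].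
  by rewrite /area measure0 mule0.
rewrite -(ge0_integral_mscale _ _ (NngNum Di0)) //; last exact: measurable_funTS.
by apply: eq_measure_integral => A mA AT; rewrite [LHS]distE // setIidl.
Qed.

(** * The integral over directions *)

Lemma integral_bernstein (R : realType) (k i : nat) : (i <= k)%N ->
  (\int[lebesgue_measure]_(x in `[0%R, 1%R]) (x ^+ i * (1 - x) ^+ (k - i))%:E =
   ((k.+1%:R * 'C(k, i)%:R)^-1 : R)%:E)%E.
Proof.
move=> ik.
transitivity ((beta_fun i.+1 (k - i).+1 : R)%:E).
  rewrite EFin_beta_fun integral_mkcond; apply: eq_integral => x _.
  by rewrite !patchE; case: ifP.
rewrite beta_fun_fact subnKC // factS -(bin_fact ik) !natrM.
congr EFin.
have f0 n : (n`!%:R : R) != 0 by rewrite pnatr_eq0 -lt0n fact_gt0.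
have c0 : ('C(k, i)%:R : R) != 0 by rewrite pnatr_eq0 -lt0n bin_gt0.
by field; rewrite !f0 c0 /= addrC natr1 pnatr_eq0.
Qed.

Lemma ge0_integral_symmetric (R : realType) (h : R -> \bar R) :
  measurable_fun setT h -> (forall u, 0 <= h u)%E ->
  (\int[lebesgue_measure]_(u in `[(-1)%R, 1%R]) h u =
   \int[lebesgue_measure]_(u in `[0%R, 1%R]) (h u + h (- u)%R))%E.
Proof.
move=> mh h0.
have mhN : measurable_fun [set: R] (fun u => h (- u)).
  by apply: measurableT_comp => //; measurable_poly.
have -> : `[(-1), 1]%classic = `[(-1 : R), 0[%classic `|` `[0, 1]%classic.
  by rewrite -itv_bndbnd_setU // bnd_simp; lra.
rewrite ge0_integral_setU //=; last 2 first.
- exact: measurable_funTS.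
- apply/disj_set2P; apply/seteqP; split => // u /= [].
  by rewrite !in_itv /= => /andP[_ ?] /andP[? _]; lra.
rewrite ge0_integralD //; last 2 first.
- exact: measurable_funTS.
- exact: measurable_funTS.
rewrite addeC; congr (_ + _)%E.
rewrite -[RHS]integral_itv_obnd_cbnd; last exact: measurable_funTS.
rewrite [LHS]integral_mkcond [RHS]integral_mkcond.
rewrite -[LHS]mul1e -[X in (X%:E * _)%E]invr1 -[X in (X^-1%:E * _)%E](normrN1 R).
rewrite -(@ge0_integral_affine _ _ 0 (h \_ `[-1, 0[)) ?oppr_eq0 ?oner_eq0 //; last 2 first.
- by apply/(measurable_restrictT _ _).1 => //; exact: measurable_funTS.
- by move=> t; rewrite patchE; case: ifP.
apply: eq_integral => u _.
rewrite addr0 mulN1r !patchE !mem_setE !in_itv /= lerN2 oppr_lt0 andbC.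
by [].
Qed.

Lemma integral_abs_difference (R : realType) (k : nat) (u : R) : 0 <= u <= 1 ->
  (\int[lebesgue_measure]_(v in `[0%R, 1%R]) (`|u - v| ^+ k)%:E =
   ((u ^+ k.+1 + (1 - u) ^+ k.+1) / k.+1%:R)%:E)%E.
Proof.
move=> /andP[u0 u1].
have mf D : measurable_fun D (fun v : R => (`|u - v| ^+ k)%:E).
  by apply: measurable_funTS; apply/measurable_EFinP; measurable_poly.
have -> : `[0, 1]%classic = `[0, u[%classic `|` `[u, 1]%classic.
  by rewrite -itv_bndbnd_setU // bnd_simp.
rewrite ge0_integral_setU //=; last 2 first.
- exact: mf.
- apply/disj_set2P; apply/seteqP; split => // v /= [].
  by rewrite !in_itv /= => /andP[_ ?] /andP[? _]; lra.
rewrite integral_itv_bndo_bndc; last exact: mf.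
transitivity (\int[lebesgue_measure]_(v in `[0%R, u]) ((- 1 * v + u) ^+ k)%:E +
  \int[lebesgue_measure]_(v in `[u, 1%R]) ((1 * v + - u) ^+ k)%:E)%E.
  congr (_ + _)%E; apply: eq_integral => v; rewrite mem_setE in_itv /= => /andP[v1 v2].
    by rewrite ger0_norm ?subr_ge0 // mulN1r addrC.
  by rewrite distrC ger0_norm ?subr_ge0 // mul1r.
rewrite !integral_affine_power ?oppr_eq0 ?oner_eq0 // -EFinD; congr EFin.
have -> : -1 * u + u = 0 by ring.
have -> : -1 * 0 + u = u by ring.
rewrite !mul1r subrr !expr0n /= subr0 sub0r mulN1r invrN mulrNN.
by rewrite [RHS]mulrDl.
Qed.

(** Expanded by the binomial theorem, the integrand is a combination of the
    Bernstein polynomials of degree [k] in [v], and these, with their binomial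
    coefficients, all have integral [1 / (k + 1)]. *)
Lemma integral_mixture_power (R : realType) (k : nat) (u : R) : 0 <= u <= 1 ->
  (\int[lebesgue_measure]_(v in `[0%R, 1%R]) ((u * (1 - v) + v * (1 - u)) ^+ k)%:E =
   (k.+1%:R^-1 * \sum_(i < k.+1) u ^+ (k - i) * (1 - u) ^+ i)%:E)%E.
Proof.
move=> /andP[u0 u1].
pose F (i : 'I_k.+1) (v : R) :=
  (('C(k, i)%:R * (u ^+ (k - i) * (1 - u) ^+ i))%:E * (v ^+ i * (1 - v) ^+ (k - i))%:E)%E.
transitivity (\int[lebesgue_measure]_(v in `[0%R, 1%R]) \sum_(i < k.+1) F i v)%E.
  apply: eq_integral => v _; rewrite exprDn -sumEFin; apply: eq_bigr => i _.
  rewrite /F -EFinM; congr EFin; rewrite !exprMn -mulr_natl.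
  move: (u ^+ _) ((1 - v) ^+ _) (v ^+ _) ((1 - u) ^+ _) => p q r s; ring.
have c0 i : 0 <= 'C(k, i)%:R * (u ^+ (k - i) * (1 - u) ^+ i).
  by rewrite mulr_ge0 // mulr_ge0 // exprn_ge0 // subr_ge0.
have b0 (i : nat) v : 0 <= v <= 1 -> 0 <= v ^+ i * (1 - v) ^+ (k - i).
  by move=> /andP[v0 v1]; rewrite mulr_ge0 // exprn_ge0 // subr_ge0.
have mb i D : measurable_fun D (fun v : R => (v ^+ i * (1 - v) ^+ (k - i))%:E).
  by apply: measurable_funTS; apply/measurable_EFinP; measurable_poly.
rewrite ge0_integral_sum //; last 2 first.
- by move=> i; apply: measurable_funeM; exact: mb.
- move=> i v; rewrite /= in_itv /= => v01.
  by rewrite mule_ge0 // lee_fin ?c0 ?b0.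
rewrite mulr_sumr -sumEFin; apply: eq_bigr => i _.
have ik : (i <= k)%N by rewrite -ltnS.
rewrite ge0_integralZl //; last 3 first.
- exact: mb.
- by move=> v; rewrite /= in_itv /= => v01; rewrite lee_fin b0.
- by rewrite lee_fin.
rewrite integral_bernstein // -EFinM; congr EFin.
have C0 : ('C(k, i)%:R : R) != 0 by rewrite pnatr_eq0 -lt0n bin_gt0.
have k0 : (k.+1%:R : R) != 0 by rewrite pnatr_eq0.
by move: (k.+1%:R : R) k0 ('C(k, i)%:R : R) C0 (u ^+ _ * _) => p p0 c c0' q; field; rewrite p0.
Qed.

Lemma measurable_lebesgue_integral_in (R : realType) (D : set R) (f : R * R -> \bar R) :
  measurable D -> measurable_fun setT f -> (forall z, 0 <= f z)%E ->
  measurable_fun [set: R] (fun s => \int[lebesgue_measure]_(t in D) f (s, t))%E.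
Proof.
move=> mD mf f0.
pose g := f \_ (setT `*` D).
have mg : measurable_fun setT g.
  apply/(measurable_restrictT _ _).1; first exact: measurableX.
  exact: measurable_funTS.
have g0 z : (0 <= g z)%E by rewrite /g patchE; case: ifP.
rewrite (_ : (fun s => _) = fun s => \int[lebesgue_measure]_t g (s, t))%E.
  exact: measurable_lebesgue_integral1.
apply/funext => s; rewrite integral_mkcond; apply: eq_integral => t _.
rewrite /g !patchE; congr (if _ then _ else _).
by apply/idP/idP; rewrite !inE; [split|case].
Qed.

(** Folding [v] onto [0, 1] yields both sign patterns, whatever the sign of [w]:
    changing that sign only exchanges the two terms. *)
Lemma integral_direction_fibre (R : realType) (k : nat) (u w : R) :
  0 <= u <= 1 -> `|w| = u ->
  (\int[lebesgue_measure]_(v in `[(-1)%R, 1%R])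
      (`|w * (1 - `|v|) - v * (1 - `|w|)| ^+ k)%:E =
   (k.+1%:R^-1 * (u ^+ k.+1 + (1 - u) ^+ k.+1 +
      \sum_(i < k.+1) u ^+ (k - i) * (1 - u) ^+ i))%:E)%E.
Proof.
move=> u01 wu.
rewrite (@ge0_integral_symmetric R (fun v =>
    (`|w * (1 - `|v|) - v * (1 - `|w|)| ^+ k)%:E)); last 2 first.
- by apply/measurable_EFinP; measurable_poly.
- by move=> v; rewrite lee_fin exprn_ge0.
transitivity (\int[lebesgue_measure]_(v in `[0%R, 1%R])
    ((`|u - v| ^+ k)%:E + ((u * (1 - v) + v * (1 - u)) ^+ k)%:E))%E.
  have E (v : R) : 0 <= v <= 1 ->
      `|w * (1 - `|v|) - v * (1 - `|w|)| ^+ k + `|w * (1 - `|- v|) - - v * (1 - `|w|)| ^+ k =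
      `|u - v| ^+ k + (u * (1 - v) + v * (1 - u)) ^+ k.
    move=> /andP[v0 v1]; case/andP: u01 => u0 u1.
    have m0 : 0 <= u * (1 - v) + v * (1 - u) by rewrite addr_ge0 // mulr_ge0 // subr_ge0.
    rewrite normrN wu (ger0_norm v0) -[in RHS](ger0_norm m0).
    have [w0|w0] := leP 0 w.
      have -> : w = u by rewrite -wu ger0_norm.
      have -> : u * (1 - v) - v * (1 - u) = u - v by ring.
      by have -> : u * (1 - v) - - v * (1 - u) = u * (1 - v) + v * (1 - u) by ring.
    have -> : w = - u by rewrite -wu (ltr0_norm w0) opprK.
    have -> : - u * (1 - v) - v * (1 - u) = - (u * (1 - v) + v * (1 - u)) by ring.
    have -> : - u * (1 - v) - - v * (1 - u) = - (u - v) by ring.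
    by rewrite !normrN addrC.
  apply: eq_integral => v; rewrite mem_setE in_itv /= => v01.
  by rewrite -!EFinD E.
rewrite ge0_integralD //; last 3 first.
- by apply: measurable_funTS; apply/measurable_EFinP; measurable_poly.
- move=> v; rewrite /= in_itv /= => /andP[v0 v1]; case/andP: u01 => u0 u1.
  by rewrite lee_fin exprn_ge0 // addr_ge0 // mulr_ge0 // subr_ge0.
- by apply: measurable_funTS; apply/measurable_EFinP; measurable_poly.
rewrite integral_abs_difference // integral_mixture_power // -EFinD; congr EFin.
by rewrite [RHS]mulrDr mulrC.
Qed.

Lemma integral_directions (R : realType) (k : nat) :
  (\int[lebesgue_measure]_(u in `[(-1)%R, 1%R]) \int[lebesgue_measure]_(v in `[(-1)%R, 1%R])
      (`|u * (1 - `|v|) - v * (1 - `|u|)| ^+ k)%:E =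
   (2 / k.+1%:R * (2 / k.+2%:R + k.+1%:R^-1 * \sum_(i < k.+1) ('C(k, i)%:R)^-1) : R)%:E)%E.
Proof.
rewrite ge0_integral_symmetric; last 2 first.
- apply: (@measurable_lebesgue_integral_in R _ (fun z =>
    (`|z.1 * (1 - `|z.2|) - z.2 * (1 - `|z.1|)| ^+ k)%:E)) => //.
  by apply/measurable_EFinP; measurable_poly.
- by move=> u; apply: integral_ge0 => v _; rewrite lee_fin exprn_ge0.
(* The fibre integral at [u] is, up to the factor [1 / (k + 1)], a sum of such
   products; the fibre at [- u] gives the same value, hence the factor [2]. *)
pose B (j n : nat) (u : R) := (u ^+ j * (1 - u) ^+ (n - j))%:E.
have mB j n D : measurable_fun D (B j n).
  by apply: measurable_funTS; apply/measurable_EFinP; measurable_poly.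
have B0 j n u : `[0, 1]%classic u -> (0 <= B j n u)%E.
  rewrite /= in_itv /= => /andP[u0 u1].
  by rewrite lee_fin mulr_ge0 // exprn_ge0 // subr_ge0.
have S0 u : `[0, 1]%classic u -> (0 <= \sum_(i < k.+1) B (k - i)%N k u)%E.
  by move=> u01; apply: sume_ge0 => i _; exact: B0.
have mS D : measurable_fun D (fun u => \sum_(i < k.+1) B (k - i)%N k u)%E.
  by apply: emeasurable_sum => i; exact: mB.
transitivity (\int[lebesgue_measure]_(u in `[0%R, 1%R]) ((2 / k.+1%:R)%:E *
    (B k.+1 k.+1 u + B 0%N k.+1 u + \sum_(i < k.+1) B (k - i)%N k u)))%E.
  apply: eq_integral => u; rewrite mem_setE in_itv /= => u01.
  rewrite !(@integral_direction_fibre R k u) // ?normrN; last 2 first.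
  - by case/andP: u01 => u0 _; rewrite ger0_norm.
  - by case/andP: u01 => u0 _; rewrite ger0_norm.
  have -> : (\sum_(i < k.+1) B (k - i)%N k u =
      (\sum_(i < k.+1) u ^+ (k - i) * (1 - u) ^+ i)%:E)%E.
    rewrite -sumEFin; apply: eq_bigr => i _; rewrite /B subKn //.
    by rewrite -ltnS.
  rewrite /B subnn subn0 !expr0 mulr1 mul1r -!EFinD -EFinM; congr EFin.
  by ring.
rewrite ge0_integralZl //; last 2 first.
- apply: emeasurable_funD; last exact: mS.
  apply: emeasurable_funD; exact: mB.
- by move=> u u01; apply: adde_ge0; [apply: adde_ge0; exact: B0|exact: S0].
rewrite ge0_integralD //; last 3 first.
- by move=> u u01; apply: adde_ge0; exact: B0.
- by apply: emeasurable_funD; exact: mB.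
- exact: mS.
rewrite ge0_integralD //; try exact: mB; try exact: B0.
rewrite ge0_integral_sum //; try (by move=> i; exact: mB); try (by move=> i u; exact: B0).
rewrite !integral_bernstein // bin0 binn !mulr1 -!EFinD.
rewrite (_ : (\sum_(i < k.+1) _)%E = (k.+1%:R^-1 * \sum_(i < k.+1) ('C(k, i)%:R)^-1)%:E).
  by rewrite -EFinD -EFinM; congr EFin; congr (_ * (_ + _)); ring.
rewrite mulr_sumr -sumEFin; apply: eq_bigr => i _.
rewrite integral_bernstein ?leq_subr // bin_sub ?invfM //.
by rewrite -ltnS.
Qed.

(** * Sums of inverse binomial coefficients *)

(** Both terms are multiples of [1 / C(n, i)], with numerators [n + 1 - i] and
    [i + 1] over [n + 1]. *)
Lemma inv_bin_pascal (R : numFieldType) (n i : nat) : (i <= n)%N ->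
  ('C(n.+1, i)%:R)^-1 + ('C(n.+1, i.+1)%:R)^-1 =
  n.+2%:R / n.+1%:R * ('C(n, i)%:R)^-1 :> R.
Proof.
move=> le_in.
have n0 : (n.+1%:R : R) != 0 by rewrite pnatr_eq0.
have i0 : (i.+1%:R : R) != 0 by rewrite pnatr_eq0.
have ni0 : ((n.+1 - i)%:R : R) != 0 by rewrite pnatr_eq0 -lt0n subn_gt0 ltnS.
have c0 : ('C(n, i)%:R : R) != 0 by rewrite pnatr_eq0 -lt0n bin_gt0.
have -> : ('C(n.+1, i.+1)%:R : R) = n.+1%:R * 'C(n, i)%:R / i.+1%:R.
  by rewrite -natrM mul_bin_diag natrM mulrAC mulfV // mul1r.
have -> : ('C(n.+1, i)%:R : R) = n.+1%:R * 'C(n, i)%:R / (n.+1 - i)%:R.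
  by rewrite -natrM (mul_bin_down n.+1 i) natrM mulrAC mulfV // mul1r.
have -> : n.+2%:R = (n.+1 - i)%:R + i.+1%:R :> R.
  by rewrite -natrD addnS subnK // ltnW.
move: n0 i0 ni0 c0.
move: (n.+1%:R : R) (i.+1%:R : R) ((n.+1 - i)%:R : R) ('C(n, i)%:R : R).
by move=> p q r c p0 q0 r0 c0; field; rewrite p0 q0 r0 c0.
Qed.

(** Summing [inv_bin_pascal] over [i] counts every entry of row [n + 1] twice,
    except the two extreme ones, which are equal to [1]. *)
Lemma sum_inv_bin_rec (R : numFieldType) (n : nat) :
  \sum_(i < n.+2) ('C(n.+1, i)%:R)^-1 =
  n.+2%:R / (2 * n.+1%:R) * \sum_(i < n.+1) ('C(n, i)%:R)^-1 + 1 :> R.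
Proof.
have n0 : (n.+1%:R : R) != 0 by rewrite pnatr_eq0.
pose S : R := \sum_(i < n.+2) ('C(n.+1, i)%:R)^-1.
have first : S = 1 + \sum_(i < n.+1) ('C(n.+1, i.+1)%:R)^-1.
  by rewrite /S big_ord_recl bin0 invr1.
have last : S = \sum_(i < n.+1) ('C(n.+1, i)%:R)^-1 + 1.
  by rewrite /S big_ord_recr /= binn invr1.
have sum : S + S = n.+2%:R / n.+1%:R * \sum_(i < n.+1) ('C(n, i)%:R)^-1 + 2.
  have addS (x y : R) : S = x + 1 -> S = 1 + y -> S + S = x + y + 2.
    by move=> Sx Sy; rewrite {1}Sx Sy; ring.
  rewrite (addS _ _ last first) -big_split /= mulr_sumr; congr (_ + _).
  by apply: eq_bigr => i _; rewrite inv_bin_pascal // -ltnS.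
rewrite -/S; have -> : S = 2^-1 * (S + S) by field.
rewrite sum; move: (n.+1%:R : R) n0 (n.+2%:R : R) (\sum_(i < _) _) => p p0 q T.
by field.
Qed.

Lemma directions_binomial_identity (R : numFieldType) (k : nat) :
  2 / k.+1%:R * (2 / k.+2%:R + k.+1%:R^-1 * \sum_(i < k.+1) ('C(k, i)%:R)^-1) =
  8 / (k.+1%:R * k.+3%:R) * (\sum_(1 <= l < k.+2) ('C(k.+2, l)%:R)^-1 + 1) :> R.
Proof.
have -> : \sum_(1 <= l < k.+2) ('C(k.+2, l)%:R)^-1 + 1 =
    \sum_(i < k.+3) ('C(k.+2, i)%:R)^-1 - 1 :> R.
  rewrite -(big_mkord xpredT (fun i => ('C(k.+2, i)%:R)^-1 : R)).
  rewrite [in RHS]big_ltn // [in RHS]big_nat_recr //= bin0 binn invr1.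
  by ring.
rewrite !sum_inv_bin_rec.
have n0 n : (n.+1%:R : R) != 0 by rewrite pnatr_eq0.
move: (n0 k) (n0 k.+1) (n0 k.+2).
move: (k.+1%:R : R) (k.+2%:R : R) (k.+3%:R : R) (\sum_(i < _) _) => p q r T p0 q0 r0.
by field; rewrite p0 q0 r0.
Qed.

(** * The moments *)

Lemma integral_radial (R : realType) (k : nat) (c : R) (L : R -> \bar R) :
  0 <= c -> measurable_fun setT L -> (forall u, 0 <= L u)%E ->
  (\int[lebesgue_measure]_(r in `[0%R, 1%R]) \int[lebesgue_measure]_(u in `[(-1)%R, 1%R])
     (r%:E * ((c * r ^+ k)%:E * L u)) =
   (c / k.+2%:R)%:E * \int[lebesgue_measure]_(u in `[(-1)%R, 1%R]) L u)%E.
Proof.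
move=> c0 mL L0; set I := (X in (_ * X)%E).
have I0 : (0 <= I)%E by apply: integral_ge0.
transitivity (\int[lebesgue_measure]_(r in `[0%R, 1%R]) ((c%:E * I) * ((1 * r + 0) ^+ k.+1)%:E))%E.
  apply: eq_integral => r; rewrite mem_setE in_itv /= => /andP[r0 r1].
  rewrite mul1r addr0 muleAC -EFinM exprS mulrCA.
  rewrite -ge0_integralZl //; last 2 first.
  - exact: measurable_funTS.
  - by rewrite lee_fin mulr_ge0 // mulr_ge0 // exprn_ge0.
  by apply: eq_integral => u _; rewrite muleA -EFinM.
rewrite ge0_integralZl //; last 3 first.
- by apply: measurable_funTS; apply/measurable_EFinP; measurable_poly.
- move=> r; rewrite /= in_itv /= => /andP[r0 _].
  by rewrite lee_fin mul1r addr0 exprn_ge0.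
- by rewrite mule_ge0.
rewrite integral_affine_power ?oner_eq0 // muleAC -EFinM; congr (_%:E * _)%E.
by rewrite !mul1r !addr0 expr1n expr0n subr0 /= mul1r.
Qed.

Lemma ge0_integral_uniform_median_triangle (R : realType) (d : measure_display)
    (Omega : measurableType d) (P : probability Omega R)
    (m e f : R * R) (X : {RV P >-> (R * R)%type}) (G : R * R -> \bar R) :
  wedge e f != 0 -> uniform_on P (median_triangle m e f) X ->
  measurable_fun setT G -> (forall z, 0 <= G z)%E ->
  (\int[distribution P X]_z G z =
   \int[lebesgue_measure]_(r in `[0%R, 1%R])
     \int[lebesgue_measure]_(u in `[(-1)%R, 1%R])
       (r%:E * G (frame m e f (r * u, r * (1 - `|u|))%R)))%E.
Proof.
move=> w0 uX mG G0.
have wn0 : 0 < `|wedge e f| by rewrite normr_gt0.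
rewrite (ge0_integral_uniform_on uX (measurable_median_triangle m w0) wn0
  (area_median_triangle m e f) mG G0).
by rewrite ge0_integral_median_triangle // muleA -EFinM mulVf ?gt_eqF // mul1e.
Qed.

Lemma hull_area_frame (R : realType) (m e f : R * R) (r u s v : R) :
  hull_area m (frame m e f (r * u, r * (1 - `|u|))) (frame m e f (s * v, s * (1 - `|v|))) =
  `|wedge e f| / 2 * `|r| * `|s| * `|u * (1 - `|v|) - v * (1 - `|u|)|.
Proof.
rewrite hull_areaE mulrAC -[RHS]mulrAC.
rewrite [RHS](_ : _ = `|wedge e f| * `|r| * `|s| *
  `|u * (1 - `|v|) - v * (1 - `|u|)| / 2); last by ring.
rewrite -!normrM; congr (`| _ | / 2); rewrite /wedge /frame /=; ring.
Qed.

(** Both points in polar coordinates: the integrand is a product of powers of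
    the two radii and of a function of the two directions, so that
    [integral_radial] removes the radii one after the other. *)
Lemma expectation_hull_area (R : realType) (d : measure_display)
    (Omega : measurableType d) (P : probability Omega R)
    (X1 X2 : {RV P >-> (R * R)%type}) (m e f : R * R) (k : nat) :
  wedge e f != 0 -> independent_RVs P X1 X2 ->
  uniform_on P (median_triangle m e f) X1 ->
  uniform_on P (median_triangle m e f) X2 ->
  ('E_P[fun w => (hull_area m (X1 w) (X2 w) ^+ k)%R] =
   ((`|wedge e f| / 2) ^+ k / k.+2%:R ^+ 2 *
    (2 / k.+1%:R * (2 / k.+2%:R + k.+1%:R^-1 * \sum_(i < k.+1) ('C(k, i)%:R)^-1)))%:E)%E.
Proof.
move=> w0 indep u1 u2.
set c := `|wedge e f| / 2; have c0 : 0 <= c by rewrite divr_ge0.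
pose F (z : (R * R) * (R * R)) := ((hull_area m z.1 z.2) ^+ k)%:E.
have FE : F = fun z => ((`|wedge (z.1 - m) (z.2 - m)| / 2) ^+ k)%:E.
  by apply/funext => z; rewrite /F hull_areaE.
have mF : measurable_fun setT F.
  rewrite FE; apply/measurable_EFinP.
  have m11 : measurable_fun setT (fun z : (R * R) * (R * R) => z.1.1 : R).
    exact: (measurableT_comp measurable_fst measurable_fst).
  have m12 : measurable_fun setT (fun z : (R * R) * (R * R) => z.1.2 : R).
    exact: (measurableT_comp measurable_snd measurable_fst).
  have m21 : measurable_fun setT (fun z : (R * R) * (R * R) => z.2.1 : R).
    exact: (measurableT_comp measurable_fst measurable_snd).
  have m22 : measurable_fun setT (fun z : (R * R) * (R * R) => z.2.2 : R).
    exact: (measurableT_comp measurable_snd measurable_snd).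
  by rewrite /wedge /=; measurable_poly.
have F0 z : (0 <= F z)%E by rewrite FE lee_fin exprn_ge0 // divr_ge0.
have mF2 y : measurable_fun setT (fun z => F (y, z)) by exact: measurableT_comp.
pose K (u v : R) : R := u * (1 - `|v|) - v * (1 - `|u|).
pose L (u : R) := (\int[lebesgue_measure]_(v in `[(-1)%R, 1%R]) (`|K u v| ^+ k)%:E)%E.
have L0 u : (0 <= L u)%E by apply: integral_ge0 => v _; rewrite lee_fin exprn_ge0.
have mL : measurable_fun [set: R] L.
  apply: (@measurable_lebesgue_integral_in R _ (fun z => (`|K z.1 z.2| ^+ k)%:E)) => //.
  by apply/measurable_EFinP; rewrite /K; measurable_poly.
rewrite unlock (ge0_integral_independent indep mF F0).
(* [H] is kept as an integral against the law of [X2], which makes its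
   measurability a consequence of Tonelli's theorem. *)
pose H y := (\int[distribution P X2]_z F (y, z))%E.
have H0 y : (0 <= H y)%E by apply: integral_ge0 => z _; exact: F0.
have mH : measurable_fun setT H.
  exact: (@measurable_fun_fubini_tonelli_F _ _ _ _ R (distribution P X2) F mF F0).
rewrite (ge0_integral_uniform_median_triangle w0 u1 mH H0).
have HE (r u : R) : 0 <= r -> H (frame m e f (r * u, r * (1 - `|u|))) =
    ((c ^+ k / k.+2%:R * r ^+ k)%:E * L u)%E.
  move=> r0; rewrite /H (ge0_integral_uniform_median_triangle w0 u2 (mF2 _)) //.
  transitivity (\int[lebesgue_measure]_(s in `[0%R, 1%R])
    \int[lebesgue_measure]_(v in `[(-1)%R, 1%R])
     (s%:E * (((c * r) ^+ k * s ^+ k)%:E * (`|K u v| ^+ k)%:E)))%E.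
    apply: eq_integral => s; rewrite mem_setE in_itv /= => /andP[s0 s1].
    apply: eq_integral => v _; congr (_ * _)%E.
    rewrite /F /= hull_area_frame -EFinM (ger0_norm r0) (ger0_norm s0).
    by rewrite -!exprMn.
  rewrite (@integral_radial R k _ (fun v : R => (`|K u v| ^+ k)%:E)) //.
  - by congr (_%:E * _)%E; rewrite exprMn mulrAC.
  - by rewrite exprn_ge0 // mulr_ge0.
  - by apply/measurable_EFinP; rewrite /K; measurable_poly.
transitivity (\int[lebesgue_measure]_(r in `[0%R, 1%R]) \int[lebesgue_measure]_(u in `[(-1)%R, 1%R])
     (r%:E * ((c ^+ k / k.+2%:R * r ^+ k)%:E * L u)))%E.
  apply: eq_integral => r; rewrite mem_setE in_itv /= => /andP[r0 r1].
  by apply: eq_integral => u _; rewrite HE.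
rewrite integral_radial //; last by rewrite divr_ge0 // exprn_ge0.
rewrite /L /K integral_directions -EFinM; congr EFin; congr (_ * _).
by rewrite -mulrA -invfM expr2.
Qed.

Theorem theorem3 (R : realType) (v : 'I_3 -> R * R) (T : set (R * R))
    (x : R * R) (d : measure_display) (Omega : measurableType d)
    (P : probability Omega R) (X1 X2 : {RV P >-> (R * R)%type}) (k : nat) :
  is_triangle v T ->
  is_edge_midpoint v x ->
  independent_RVs P X1 X2 ->
  uniform_on P T X1 ->
  uniform_on P T X2 ->
  (0 < k)%N ->
  ('E_P[fun w => (hull_area x (X1 w) (X2 w) ^+ k)%R] / area T ^+ k)%E =
  ((2 : R) ^ (3 - k%:Z) / ((k.+1 * k.+2 ^ 2 * k.+3)%N)%:R *
     (\sum_(1 <= l < k.+2) ('C(k.+2, l)%:R)^-1 + 1))%:E.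
Proof.
move=> Ttri xmid indep u1 u2 _.
have [e [f [w0 TE]]] := is_triangle_median Ttri xmid.
rewrite TE in u1 u2 *.
rewrite (expectation_hull_area k w0 indep u1 u2) area_median_triangle.
rewrite directions_binomial_identity -EFin_expe.
have D0 : `|wedge e f| ^+ k != 0 by rewrite expf_neq0 // normr_eq0.
have t0 : (2 ^+ k : R) != 0 by rewrite expf_neq0 // pnatr_eq0.
rewrite inver (negbTE D0) -EFinM; congr EFin.
rewrite expfzDr ?pnatr_eq0 // -exprnN -exprnP expr_div_n !natrM.
have n0 n : (n.+1%:R : R) != 0 by rewrite pnatr_eq0.
move: (n0 k) (n0 k.+1) (n0 k.+2).
move: (k.+1%:R : R) (k.+2%:R : R) (k.+3%:R : R) (`|wedge e f| ^+ k) D0.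
move: (2 ^+ k : R) t0 (\sum_(1 <= l < _) _).
move=> t t0 S p q r D D0 p0 q0 r0.
by field; rewrite p0 q0 r0 D0 t0.
Qed.
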